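(* Let $P$ and $Q$ be probability measures on a measurable space $\mathcal{X}$, let $Q = Q_a + Q_s$ be the Lebesgue decomposition of $Q$ with respect to $P$ ($Q_a \ll P$, $Q_s \perp P$), and let $U : [0,\infty] \to [-\infty,\infty]$ be measurable. Suppose that $U$ is concave, upper semicontinuous and finite on $(0,\infty)$, and assume there exists some $K\ge 0$ such that $$U(y)-U(x) \le K\log(y/x), \quad \text{for } 1\le x\le y<\infty.$$ Then there exists a pair $(\lambda^*,\varepsilon^* )$, with $\lambda^*\in[0,\infty)$ and $\varepsilon^*$ a valid e-value for $H=\{P\}$, such that $$\varepsilon^*(x) \in \operatorname*{arg\,max}_{z \in [0,\infty)} \left\{\frac{dQ_a}{dP}(x)\, U(z) - \lambda^* z\right\}, \quad P\text{-a.s.},$$ $\lambda^*(1-\mathrm{E}^P[\varepsilon^*])=0$, and $U(\varepsilon^* )$ is finite $Q_a$-almost surely; consequently a $U$-optimal e-value exists.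
   Context: Notation: $\mathrm{E}^\mu[f]=\int f\,d\mu$ for any nonnegative measure $\mu$; $dQ_a/dP$ is a $[0,\infty)$-valued version of the Radon--Nikodym derivative; convention $0\times U(z)=0$. Concavity and upper semicontinuity of $U$ are understood on $[0,\infty)$ (valid e-values are finite $P$-a.s., hence $Q_a$-a.s., so $U(\infty)$ is immaterial); ''finite on $(0,\infty)$'' allows $U(0)=-\infty$. An e-value is a measurable map $\varepsilon:\mathcal{X}\to[0,\infty]$; it is valid for the simple hypothesis $H=\{P\}$ if $\mathrm{E}^P[\varepsilon]\le 1$. A valid e-value $\varepsilon^*$ is $U$-optimal (against $Q_a$) if, for every valid e-value $\varepsilon$, $\mathrm{E}^{Q_a}[U(\varepsilon^* )-U(\varepsilon)]$ is well-defined and $\geq 0$. Here ''well-defined'' means that the integrand avoids an ambiguous $\infty-\infty$ $Q_a$-almost surely, and that its positive part or its negative part has finite $Q_a$-expectation. *)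

(* Defs.v *)
From HB Require Import structures.
From mathcomp Require Import all_boot all_order all_algebra.
From mathcomp Require Import all_classical all_reals all_analysis measurable_realfun.

Set Implicit Arguments.
Unset Strict Implicit.
Unset Printing Implicit Defensive.

Import Order.TTheory GRing.Theory Num.Theory.
Import numFieldNormedType.Exports.

Local Open Scope classical_set_scope.
Local Open Scope ring_scope.
Local Open Scope ereal_scope.

(* The library's only lower-semicontinuity predicate is on the whole space;
   this one is relative to the subspace topology of D. *)
Definition upper_semicontinuous_on (R : realType) (D : set R)
    (f : R -> \bar R) : Prop :=
  forall (x a : R), D x -> f x < a%:E ->
    \forall y \near within D (nbhs x), f y < a%:E.

(* The library's convex_function is for finite-valued functions. Here
   0 * (-oo) = 0, and -oo + +oo = -oo; the latter sum does not occur when f is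
   finite except possibly at one point. *)
Definition concave_on (R : realType) (D : set R) (f : R -> \bar R) : Prop :=
  forall (x y t : R), D x -> D y -> (0 <= t <= 1)%R ->
    t%:E * f x + (1 - t)%:E * f y <= f (t * x + (1 - t) * y)%R.

Definition argmax (A : Type) (R : realType) (D : set A) (f : A -> \bar R) :
  set A := [set z | D z /\ forall w, D w -> f w <= f z].

Definition mutually_singular d (T : measurableType d) (R : realType)
    (mu nu : {measure set T -> \bar R}) : Prop :=
  exists A : set T, [/\ measurable A, mu A = 0 & nu (~` A) = 0].

Definition lebesgue_decomposition d (T : measurableType d) (R : realType)
    (nu mu : {measure set T -> \bar R}) (nua nus : {measure set T -> \bar R}) :
  Prop :=
  [/\ (forall A, measurable A -> nu A = nua A + nus A),
      nua `<< mu & mutually_singular nus mu].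

Definition density_version d (T : measurableType d) (R : realType)
    (nu : {finite_measure set T -> \bar R})
    (mu : {sigma_finite_measure set T -> \bar R}) (q : T -> R) : Prop :=
  [/\ measurable_fun [set: T] q, (forall x, (0 <= q x)%R) &
      ae_eq mu [set: T] (EFin \o q)
        (Radon_Nikodym (charge_of_finite_measure nu) mu)].

Definition valid_evalue d (T : measurableType d) (R : realType)
    (P : probability T R) (eps : T -> \bar R) : Prop :=
  [/\ measurable_fun [set: T] eps, (forall x, 0 <= eps x) &
      \int[P]_x eps x <= 1].

(* On the Qa-null set where the difference is ambiguous, its value is -oo. *)
Definition U_optimal d (T : measurableType d) (R : realType)
    (P : probability T R) (Qa : {measure set T -> \bar R})
    (U : \bar R -> \bar R) (eps' : T -> \bar R) : Prop :=
  valid_evalue P eps' /\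
  forall eps : T -> \bar R, valid_evalue P eps ->
    let h := fun x => U (eps' x) - U (eps x) in
    [/\ {ae Qa, forall x, U (eps' x) +? - U (eps x)},
        (\int[Qa]_x h^\+ x < +oo \/ \int[Qa]_x h^\- x < +oo) &
        0 <= \int[Qa]_x h x].

(* Main.v *)
Require Import Defs.
From HB Require Import structures.
From mathcomp Require Import all_boot all_order all_algebra.
From mathcomp Require Import all_classical all_reals all_analysis measurable_realfun.
From mathcomp Require Import ring lra.

(** The theorem is Lagrangian duality for the problem of maximising the
    [Qa]-expectation of [U (eps)] over the [eps >= 0] with [P]-expectation at
    most 1.

    For a price [l > 0] and a density value [r > 0], the maximisers of
    [r * U z - l * z] are those of [U z - s * z] with [s = l / r].  They exist
    because that function is quasi-concave, upper semicontinuous and, thanks to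
    the logarithmic growth bound, eventually nonincreasing
    ([quasiconcave_usc_max], [maximizer_exists]).  Adding the two optimality
    inequalities for [s < s'] shows that every maximiser for [s'] is at most
    every maximiser for [s].  Hence any selection, here called the demand, is
    monotone in [l] and in [r]; monotonicity in [r] makes the demand at
    [q (t)] measurable in [t] without any measurable selection theorem.  The
    growth bound also keeps every maximiser below [1/2 + C / s] for some
    constant [C] ([maximizer_bound]), so that the demand at price [l] is bounded by
    [1/2 + C * q / l]: it is [P]-integrable, and its expectation is at most 1
    when [l] is large.

    Let [l*] be the supremum of the prices at which the expected demand exceeds
    1, and 0 if there is none.  The set of pairs (price, maximiser) is closed
    ([optimal_at_closed]), so pointwise limits of the demand are still optimal
    at the limiting price.  Letting the price decrease to [l*], monotone
    convergence gives an optimal e-value with expectation at most 1, and this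
    settles the case [l* = 0].  If [l* > 0], letting the price increase to [l*],
    dominated convergence gives an optimal variable with expectation at least
    1.  By concavity of [U] the optimal values form a convex set, so a convex
    combination of the two limits is optimal and has expectation exactly 1
    ([optimal_evalue_exists]).

    For the last claim, multiply [h = U (eps) - U (eps')] by the density [q].
    Pointwise optimality says that [q * h >= l* * (eps - eps')] and hence that
    [q * h^-] is at most [l* * eps'], which is integrable; integrating and using
    complementary slackness gives [0 <= \int h]
    ([optimal_at_variation], [optimal_at_U_optimal]). *)

Set Implicit Arguments.
Unset Strict Implicit.
Unset Printing Implicit Defensive.

Import Order.TTheory GRing.Theory Num.Theory.
Import numFieldNormedType.Exports.

Local Open Scope classical_set_scope.
Local Open Scope ring_scope.
Local Open Scope ereal_scope.

(** * Maxima of quasi-concave upper semicontinuous functions on a half-line *)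

Section quasiconcave_maximum.
Context {R : realType}.
Implicit Types (f : R -> \bar R) (a s w x y z : R).

Lemma ereal_real_between (x y : \bar R) : x < y -> exists a, x < a%:E < y.
Proof.
case: x y => [x| |] [y| |] //= xy.
- exists ((x + y) / 2)%R; rewrite !lte_fin in xy *; lra.
- by exists (x + 1)%R; rewrite lte_fin ltrDl ltr01 ltry.
- by exists (y - 1)%R; rewrite lte_fin ltrBlDr ltrDl ltr01 ltNyr.
- by exists 0%R; rewrite ltNyr ltry.
Qed.

Lemma usc_ball f x a : upper_semicontinuous_on [set z : R | (0 <= z)%R] f ->
  (0 <= x)%R -> f x < a%:E ->
  exists2 e : R, (0 < e)%R &
    forall y, (0 <= y)%R -> (`|x - y| < e)%R -> f y < a%:E.
Proof.
move=> usc x0 /(usc _ _ x0); rewrite /within /= => /nbhs_ballP[e e0 He].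
by exists e => // y y0 xy; exact: He.
Qed.

(** Compactness is avoided: the maximum is attained at the supremum [m] of the
    points that are not yet past it, i.e. from which a larger value is still
    reached on the right.  If [f w] exceeded [f m], then by semicontinuity
    [f < f w] near [m].  When [w < m], quasi-concavity contradicts this at such
    a point between [w] and [m]; when [m < w], the points just after [m] would
    still be such points. *)
Lemma quasiconcave_usc_max f (M : R) :
  upper_semicontinuous_on [set z : R | (0 <= z)%R] f ->
  (forall x y z, (0 <= x)%R -> (x < y)%R -> (y < z)%R -> f y < f z -> f x <= f y) ->
  (forall y z, (M <= y)%R -> (y < z)%R -> f z <= f y) ->
  exists2 z, (0 <= z)%R & forall w, (0 <= w)%R -> f w <= f z.
Proof.
move=> usc qc dec.
(* The point 0 is added so that the supremum is that of a nonempty set. *)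
pose S := [set z : R | z = 0%R \/ ((0 <= z)%R /\ exists2 y, (z < y)%R & f z < f y)].
have S0 : S 0%R by left.
have ubS : ubound S (Num.max 0 M)%R.
  move=> z [->|[z0 [y zy fzy]]]; rewrite le_max ?lexx// orbC.
  rewrite leNgt; apply/orP; left; apply/negP => /ltW Mz.
  by move: fzy; rewrite ltNge dec.
have supS : has_sup S by split; [exists 0%R|exists (Num.max 0 M)%R].
have z0 : (0 <= sup S)%R by apply: ub_le_sup => //; exists (Num.max 0 M)%R.
exists (sup S) => // w w0; rewrite leNgt; apply/negP => /ereal_real_between[a /andP[fa /ltW aw]].
have [e e0 He] := usc_ball usc z0 fa.
have [ws|sw|wE] := ltgtP w (sup S); last by move: fa; rewrite -wE ltNge aw.
- have d0 : (0 < Num.min e (sup S - w))%R by rewrite lt_min e0 subr_gt0.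
  have [z Sz] := sup_adherent d0 supS; rewrite ltrBlDr -ltrBlDl => zd.
  have zs : (z <= sup S)%R by apply: ub_le_sup => //; exists (Num.max 0 M)%R.
  have wz : (w < z)%R.
    have : (sup S - z < sup S - w)%R.
      by apply: lt_le_trans zd _; rewrite ge_min lexx orbT.
    by rewrite ltrD2l ltrN2.
  case: Sz => [zE|[zge0 [y zy fzy]]]; first by move: (le_lt_trans w0 wz); rewrite zE ltxx.
  have : f z < a%:E.
    apply: He => //; rewrite ger0_norm ?subr_ge0//.
    by apply: lt_le_trans zd _; rewrite ge_min lexx.
  by move=> /lt_le_trans/(_ aw); rewrite ltNge (qc _ _ _ w0 wz zy fzy).
- pose y := (sup S + Num.min e (w - sup S) / 2)%R.
  have d0 : (0 < Num.min e (w - sup S))%R by rewrite lt_min e0 subr_gt0.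
  have [de dw] : (Num.min e (w - sup S) <= e)%R /\ (Num.min e (w - sup S) <= w - sup S)%R.
    by rewrite !ge_min !lexx orbT.
  have Sy : S y.
    right; split; first by rewrite /y; lra.
    exists w; first by rewrite /y; lra.
    apply: lt_le_trans aw; apply: He; first by rewrite /y; lra.
    by rewrite distrC ger0_norm /y; lra.
  have : (y <= sup S)%R by apply: ub_le_sup => //; exists (Num.max 0 M)%R.
  by rewrite /y; lra.
Qed.

End quasiconcave_maximum.

(** * Maximisers of the utility minus a linear cost *)

Section maximizers.
Context {R : realType}.
Variable u : R -> \bar R.
Hypothesis concave_u : concave_on [set z : R | (0 <= z)%R] u.
Hypothesis usc_u : upper_semicontinuous_on [set z : R | (0 <= z)%R] u.
Hypothesis fin_u : forall z : R, (0 < z)%R -> u z \is a fin_num.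
Variable K : R.
Hypothesis K0 : (0 <= K)%R.
Hypothesis growth_u : forall x y : R, (1 <= x)%R -> (x <= y)%R ->
  u y - u x <= (K * ln (y / x))%:E.
Implicit Types (l s w x y z : R).

Let v z : R := fine (u z).

Let uE z : (0 < z)%R -> u z = (v z)%:E.
Proof. by move=> z0; rewrite fineK// fin_u. Qed.

(** If [u 0] were infinite, concavity between 0 and 1 would make [u (1/2)]
    infinite too. *)
Lemma utility_lty z : (0 <= z)%R -> u z < +oo.
Proof.
rewrite le_eqVlt => /predU1P[<-|/uE ->]; last exact: ltry.
rewrite ltey; apply/negP => /eqP u0.
have : (0 <= (1/2 : R) <= 1)%R by lra.
move=> /(@concave_u 0%R 1%R (1/2)%R) /= /(_ (lexx _) ler01).
rewrite u0 mulr0 add0r mulr1 gt0_muley; last by rewrite lte_fin; lra.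
by rewrite !uE; [|lra..].
Qed.

Lemma concave3 x y z : (0 <= x)%R -> (x < y)%R -> (y < z)%R ->
  u x \is a fin_num ->
  ((z - y) * fine (u x) + (y - x) * fine (u z) <= (z - x) * fine (u y))%R.
Proof.
move=> x0 xy yz ux.
have zx : (0 < z - x)%R by lra.
pose t := ((z - y) / (z - x))%R.
have tE : (t * (z - x) = z - y)%R by rewrite /t divfK// gt_eqF.
have t01 : (0 <= t <= 1)%R.
  rewrite /t divr_ge0/=; [|lra..].
  by rewrite ler_pdivrMr//; lra.
have z0 : (0 <= z)%R by lra.
have := concave_u x0 z0 t01.
have -> : (t * x + (1 - t) * z = y)%R.
  by rewrite -[RHS](subKr z) -tE; ring.
rewrite -[u x]fineK// [u z]uE ?[u y]uE; [|lra..].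
rewrite -!EFinM -EFinD lee_fin -(ler_pM2l zx) => /=.
rewrite /v => h; apply: le_trans h; rewrite le_eqVlt; apply/orP; left; apply/eqP.
have -> : (y - x = (z - x) * (1 - t))%R by rewrite mulrBr mulr1 [((z - x) * t)%R]mulrC tE; ring.
by rewrite -tE; ring.
Qed.

(** This says that [z] maximises [u w - s * w] over [w >= 0]; gathering the cost
    on one side leaves a single finite summand, which can pass to the limit in
    [s] and [z]. *)
Definition maximizer s z := (0 <= z)%R /\
  forall w, (0 <= w)%R -> u w + (s * (z - w))%:E <= u z.

Lemma maximizer_fin_num s z : maximizer s z -> u z \is a fin_num.
Proof.
move=> [z0 /(_ 1%R ler01)]; rewrite uE// -EFinD fin_numE -ltey utility_lty// andbT.
by apply: contraTN => /eqP ->.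
Qed.

Lemma maximizer_fine s z w : maximizer s z -> (0 <= w)%R ->
  u w \is a fin_num -> (fine (u w) + s * (z - w) <= fine (u z))%R.
Proof.
move=> mz w0 uw; have uz := maximizer_fin_num mz.
by move: mz => [_ /(_ w w0)]; rewrite -[u w]fineK// -[u z]fineK.
Qed.

(** The sum of the two optimality inequalities, each tested at the other
    maximiser, is [(s' - s) * (z - z') >= 0].  This comparison holds for all
    maximisers, whence for any selection. *)
Lemma maximizer_antitone s s' z z' : (s < s')%R ->
  maximizer s z -> maximizer s' z' -> (z' <= z)%R.
Proof.
move=> ss' mz mz'; rewrite leNgt; apply/negP => zz'.
have h := maximizer_fine mz mz'.1 (maximizer_fin_num mz').
have h' := maximizer_fine mz' mz.1 (maximizer_fin_num mz).
nra.
Qed.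

(** For [z >= 2], testing optimality at [z / 2] bounds [s * z / 2] by
    [u z - u (z / 2) <= K * ln 2].  For [1/2 < z < 2], testing it at 1/2 bounds
    [s * (z - 1/2)] by the increment of [u] from 1/2, which concavity controls
    by its slope on [1/4, 1/2]. *)
Lemma maximizer_bound : exists2 C : R, (0 <= C)%R &
  forall s z, (0 <= s)%R -> maximizer s z -> (s * (z - 1/2) <= C)%R.
Proof.
have ln20 : (0 <= ln 2 :> R)%R by rewrite ln_ge0// ler1n.
have Kln : (0 <= K * ln 2)%R by rewrite mulr_ge0.
pose B : R := `|v (1/2) - v (1/4)|%R.
have B0 : (0 <= B)%R by exact: normr_ge0.
exists (2 * (K * ln 2) + 6 * B)%R; first by lra.
move=> s z s0 mz; have z0 := mz.1.
have [z12|z12] := leP z (1/2)%R; first by nra.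
have uz : u z = (v z)%:E by rewrite uE//; lra.
have [z2|z2] := leP 2%R z.
- have h := @maximizer_fine _ _ (z / 2)%R mz.
  have {h} : (v (z/2) + s * (z - z/2) <= v z)%R by apply: h; [lra|apply: fin_u; lra].
  have : (v z - v (z/2) <= K * ln 2)%R.
    have lnE : (ln 2 = ln (z / (z / 2)) :> R)%R.
      by congr ln; rewrite invf_div mulrCA divff ?mulr1// gt_eqF//; lra.
    rewrite lnE -lee_fin EFinB -!uE; [|lra..].
    by apply: growth_u; lra.
  by nra.
- have h := @maximizer_fine _ _ (1/2)%R mz.
  have {h} : (v (1/2) + s * (z - 1/2) <= v z)%R by apply: h; [lra|apply: fin_u; lra].
  have : ((z - 1/2) * v (1/4) + (1/2 - 1/4) * v z <= (z - 1/4) * v (1/2))%R.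
    by apply: concave3; [lra..|apply: fin_u; lra].
  have : (v (1/2) - v (1/4) <= B)%R by exact: ler_norm.
  by nra.
Qed.

(** Past [K / s] the growth bound [K * ln (z / y) <= K * (z - y) / y] makes
    [u z - s * z] nonincreasing. *)
Lemma maximizer_exists s : (0 < s)%R -> exists z, maximizer s z.
Proof.
move=> s0.
have [| | |z z0 zmax] := @quasiconcave_usc_max R (fun z => u z - (s * z)%:E)
  (1 + K / s)%R.
- move=> x a; rewrite [X in X -> _]/= => x0; rewrite lteBlDr// -EFinD.
  move=> /ereal_real_between[b /andP[ub]]; rewrite lte_fin => ba.
  have [e e0 He] := usc_ball usc_u x0 ub.
  have d0 : (0 < (a + s * x - b) / s)%R by rewrite divr_gt0//; lra.
  apply/nbhs_ballP; exists (Num.min e ((a + s * x - b) / s))%R => /=.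
    by rewrite lt_min e0.
  move=> y; rewrite /ball/= => yxd y0; move: yxd.
  rewrite lt_min => /andP[ye yd]; rewrite EFinN lteBlDr// -EFinD.
  apply: lt_trans (He y y0 ye) _; rewrite lte_fin.
  move: yd; rewrite ltr_pdivlMr// => yd.
  have : (x - y <= `|x - y|)%R by exact: ler_norm.
  by nra.
- move=> x y z x0 xy yz.
  have [y0 z0] : (0 < y)%R /\ (0 < z)%R by lra.
  case E : (u x) (utility_lty x0) => [r| |]// _; last by rewrite leNye.
  rewrite !uE// -!EFinB lte_fin lee_fin => fyz.
  have := concave3 x0 xy yz; rewrite E -/(v y) -/(v z) /= => /(_ isT) c3.
  have d1 : (0 < z - y)%R by lra.
  rewrite -(ler_pM2l d1).
  by nra.
- move=> y z My yz.
  have Ks : (0 <= K / s)%R by rewrite divr_ge0// ltW.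
  have [y0 z0] : (0 < y)%R /\ (0 < z)%R by lra.
  have [y1 yz' Ky] : [/\ 1 <= y, y <= z & K <= s * y]%R.
    split; [lra|lra|]; rewrite mulrC -ler_pdivrMr//; lra.
  have := growth_u y1 yz'; rewrite !uE// -!EFinB !lee_fin.
  have zy : (z / y = 1 + (z - y) / y)%R by rewrite mulrBl divff ?gt_eqF// addrC subrK.
  have zyy : (0 <= (z - y) / y)%R by rewrite divr_ge0//; lra.
  have : (ln (z / y) <= (z - y) / y)%R by rewrite zy le_ln1Dx//; lra.
  move=> lnb; have : (K * ln (z / y) <= s * (z - y))%R.
    apply: le_trans (ler_wpM2l K0 lnb) _.
    by rewrite mulrA ler_pdivrMr//; nra.
  lra.
- exists z; split=> // w w0.
  have := zmax w w0; rewrite leeBrDr// -addeA -EFinN -EFinD.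
  by rewrite [(- _ + _)%R]addrC -mulrBr.
Qed.

(** The competitor [w] stays fixed in the optimality inequality, so upper
    semicontinuity at [z] is enough to pass to the limit.  Since the limit [s]
    may be 0, this is also how a maximiser of [u] itself is obtained. *)
Lemma maximizer_closed (s_ z_ : nat -> R) s z :
  (forall n, maximizer (s_ n) (z_ n)) -> s_ @ \oo --> s -> z_ @ \oo --> z ->
  maximizer s z.
Proof.
move=> mz cs cz.
have z0 : (0 <= z)%R.
  rewrite -(cvg_lim _ cz)//; apply: limr_ge; first by apply/cvg_ex; exists z.
  by apply: nearW => n; exact: (mz n).1.
split=> // w w0; rewrite leNgt; apply/negP.
case E : (u w) (utility_lty w0) => [r| |]// _; last by rewrite ltNge leNye.
rewrite -EFinD => /ereal_real_between[a /andP[ua]]; rewrite lte_fin ltNge => /negP; apply.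
have [e e0 He] := usc_ball usc_u z0 ua.
have cv : (r + s_ n * (z_ n - w))%R @[n --> \oo] --> (r + s * (z - w))%R.
  apply: cvgD; first exact: cvg_cst.
  by apply: cvgM => //; apply: cvgB => //; exact: cvg_cst.
rewrite -(cvg_lim _ cv)//; apply: limr_le; first by apply/cvg_ex; eexists; exact: cv.
have /cvgr_dist_lt/(_ e e0) := cz; apply: filterS => n zn.
have := He _ (mz n).1 zn; have [_ /(_ w w0)] := mz n.
by rewrite E -EFinD => /le_lt_trans h /h; rewrite lte_fin => /ltW.
Qed.

Lemma maximizer_convex s z z' t : (0 <= t <= 1)%R ->
  maximizer s z -> maximizer s z' -> maximizer s (t * z + (1 - t) * z')%R.
Proof.
move=> t01 mz mz'; have [z0 z'0] := (mz.1, mz'.1); have /andP[t0 t1] := t01.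
have zz : (0 <= t * z + (1 - t) * z')%R by rewrite addr_ge0// mulr_ge0// subr_ge0.
split=> // w w0; apply: le_trans (concave_u z0 z'0 t01).
have [uz uz'] := (maximizer_fin_num mz, maximizer_fin_num mz').
case E : (u w) (utility_lty w0) => [r| |]// _; last by rewrite leNye.
have uw : u w \is a fin_num by rewrite E.
have := maximizer_fine mz w0 uw; have := maximizer_fine mz' w0 uw.
rewrite -[u z]fineK// -[u z']fineK// E /= -!EFinM -!EFinD lee_fin.
by nra.
Qed.

(** Where the density [r] vanishes, the criterion is [- l * z]; the maximiser 0
    is then imposed even when [l = 0] makes every [z] optimal. *)
Definition optimal_at l r z := (0 <= z)%R /\
  if (0 < r)%R then maximizer (l / r) z else z = 0%R.

Lemma optimal_at_closed (l_ z_ : nat -> R) l r z :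
  (forall n, optimal_at (l_ n) r (z_ n)) -> l_ @ \oo --> l -> z_ @ \oo --> z ->
  optimal_at l r z.
Proof.
rewrite /optimal_at; case: ifPn => r0 oz cl cz.
- have mz : maximizer (l / r) z.
    apply: (@maximizer_closed (fun n => l_ n / r)%R z_) => //; last first.
      by apply: cvgM => //; exact: cvg_cst.
    by move=> n; exact: (oz n).2.
  by split=> //; exact: mz.1.
- have z_0 : z_ = cst 0%R by apply/funext => n; exact: (oz n).2.
  have : lim (z_ @ \oo) = z by exact: cvg_lim.
  by rewrite z_0 lim_cst// => <-.
Qed.

Lemma optimal_at_convex l r z z' t : (0 <= t <= 1)%R ->
  optimal_at l r z -> optimal_at l r z' ->
  optimal_at l r (t * z + (1 - t) * z')%R.
Proof.
rewrite /optimal_at; case: ifPn => r0 t01 [z0 oz] [z'0 oz'].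
- have mz := maximizer_convex t01 oz oz'; split=> //; exact: mz.1.
- by rewrite oz oz' !mulr0 addr0.
Qed.

Lemma optimal_at_fin_num l r z : (0 < r)%R -> optimal_at l r z ->
  u z \is a fin_num.
Proof. by rewrite /optimal_at => -> [_]; exact: maximizer_fin_num. Qed.

Lemma optimal_at_argmax l r z w : (0 <= l)%R -> (0 <= r)%R ->
  optimal_at l r z -> (0 <= w)%R ->
  r%:E * u w - (l * w)%:E <= r%:E * u z - (l * z)%:E.
Proof.
move=> l0; rewrite le_eqVlt => /predU1P[<-|r0] [z0].
  rewrite ltxx => -> w0.
  by rewrite !mul0e !add0e leeN2 lee_fin mulr0 mulr_ge0.
rewrite r0 => mz w0; have uz := maximizer_fin_num mz.
case E : (u w) (utility_lty w0) => [a| |]// _; last first.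
  by rewrite gt0_muleNy ?lte_fin// leNye.
have uw : u w \is a fin_num by rewrite E.
have := maximizer_fine mz w0 uw; rewrite E /= -(ler_pM2l r0).
have -> : (r * (a + l / r * (z - w)) = r * a + (l * z - l * w))%R.
  by rewrite mulrDr [(r * (l / r * _))%R]mulrCA mulrA mulfVK ?gt_eqF// mulrBr.
by rewrite -[u z]fineK// -!EFinM -!EFinB lee_fin; lra.
Qed.

Definition demand l r : R :=
  if (0 < r)%R then xget 0%R [set z | maximizer (l / r) z] else 0%R.

Lemma demand_optimal l r : (0 < l)%R -> optimal_at l r (demand l r).
Proof.
rewrite /optimal_at /demand => l0; case: ifPn => // r0.
have [z mz] := maximizer_exists (divr_gt0 l0 r0).
have mx : maximizer (l / r) (xget 0%R [set z | maximizer (l / r) z]).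
  by apply: xgetPex; exists z.
by split=> //; exact: mx.1.
Qed.

Lemma demand_ge0 l r : (0 < l)%R -> (0 <= demand l r)%R.
Proof. by move=> /(demand_optimal r)[]. Qed.

Lemma demand_nondecreasing l : (0 < l)%R -> nondecreasing_fun (demand l).
Proof.
move=> l0 r r'; rewrite le_eqVlt => /predU1P[->//|rr'].
have [r0|r0] := ltP 0%R r; last by rewrite {1}/demand ltNge r0 demand_ge0.
have r'0 := lt_trans r0 rr'.
have [] := (demand_optimal r l0, demand_optimal r' l0).
rewrite /optimal_at r0 r'0 => -[_ m] [_ m'].
by apply: maximizer_antitone m' m; rewrite ltr_pM2l// ltf_pV2.
Qed.

Lemma demand_antitone l l' r : (0 < l)%R -> (l <= l')%R ->
  (demand l' r <= demand l r)%R.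
Proof.
move=> l0; rewrite le_eqVlt => /predU1P[->//|ll'].
have [r0|r0] := ltP 0%R r; last by rewrite /demand ltNge r0.
have l'0 := lt_trans l0 ll'.
have [] := (demand_optimal r l0, demand_optimal r l'0).
rewrite /optimal_at r0 => -[_ m] [_ m'].
by apply: maximizer_antitone m m'; rewrite ltr_pM2r// invr_gt0.
Qed.

(** The constant term 1/2 leaves room below 1, and the other term is integrable
    at [r = q (t)] and vanishes as [l] grows: this one bound serves both as a
    dominating function and to find prices at which the budget is met. *)
Lemma demand_bound : exists2 C : R, (0 <= C)%R &
  forall l r, (0 < l)%R -> (0 <= r)%R -> (demand l r <= 1/2 + C / l * r)%R.
Proof.
have [C C0 HC] := maximizer_bound; exists C => // l r l0 r0.
have CL : (0 <= C / l * r)%R by rewrite mulr_ge0// divr_ge0// ltW.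
have [r1|r1] := ltP 0%R r; last by rewrite {1}/demand ltNge r1/=; lra.
have := demand_optimal r l0; rewrite /optimal_at r1 => -[_ m].
have lr := divr_gt0 l0 r1; have := HC _ _ (ltW lr) m.
rewrite -ler_pdivlMl// invf_div [(r / l * C)%R]mulrAC [(r * C)%R]mulrC mulrAC.
by lra.
Qed.

(** * Clearing the price *)

Section expected_demand.
Context d (T : measurableType d) (P : probability T R) (q : T -> R).
Hypothesis mq : measurable_fun [set: T] q.
Hypothesis q0 : forall t, (0 <= q t)%R.
Hypothesis iq : P.-integrable [set: T] (EFin \o q).

Definition expected_demand l := \int[P]_t (demand l (q t))%:E.

Lemma measurable_demand l : (0 < l)%R ->
  measurable_fun [set: T] (EFin \o (demand l \o q)).
Proof.
move=> l0; apply/measurable_EFinP; apply: measurableT_comp => //.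
by apply: nondecreasing_measurable => //; exact: demand_nondecreasing.
Qed.

Lemma demand_integrable l : (0 < l)%R ->
  P.-integrable [set: T] (EFin \o (demand l \o q)).
Proof.
move=> l0; have [C C0 HC] := demand_bound.
apply: (@le_integrable _ _ _ P _ measurableT _
    (fun t => (1/2)%:E + (C / l)%:E * (q t)%:E)) => //.
- exact: measurable_demand.
- move=> t _; rewrite -EFinM -EFinD !abse_EFin lee_fin.
  rewrite !ger0_norm ?demand_ge0 ?HC//.
  by rewrite addr_ge0// mulr_ge0// divr_ge0// ltW.
- apply: integrableD => //; last exact: integrableZl.
  exact: finite_measure_integrable_cst.
Qed.

Lemma expected_demand_antitone l l' : (0 < l)%R -> (l <= l')%R ->
  expected_demand l' <= expected_demand l.
Proof.
move=> l0 ll'; have l'0 := lt_le_trans l0 ll'.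
apply: ge0_le_integral => //; first by move=> t _; rewrite lee_fin demand_ge0.
- exact: measurable_demand.
- exact: measurable_demand.
- by move=> t _; rewrite lee_fin demand_antitone.
Qed.

Lemma expected_demand_le1 : exists L : R, forall l, (L <= l)%R ->
  expected_demand l <= 1.
Proof.
have [C C0 HC] := demand_bound.
have qfin : \int[P]_t (q t)%:E \is a fin_num by exact: integrable_fin_num.
pose J := fine (\int[P]_t (q t)%:E).
have J0 : (0 <= J)%R by rewrite fine_ge0// integral_ge0// => t _; rewrite lee_fin.
have CJ : (0 <= C * J)%R by rewrite mulr_ge0.
exists (2 * (C * J) + 1)%R => l Ll; have l0 : (0 < l)%R by lra.
have Cl0 : (0 <= C / l)%R by rewrite divr_ge0// ltW.
apply: (@le_trans _ _ (\int[P]_t ((1/2)%:E + (C / l)%:E * (q t)%:E))).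
  apply: ge0_le_integral => //.
  - by move=> t _; rewrite lee_fin demand_ge0.
  - exact: measurable_demand.
  - apply: emeasurable_funD => //; apply: measurable_funeM.
    exact/measurable_EFinP.
  - by move=> t _; rewrite -EFinM -EFinD lee_fin HC.
rewrite ge0_integralD//=; last 2 first.
- by move=> t _; rewrite mule_ge0// lee_fin.
- by apply: measurable_funeM; exact/measurable_EFinP.
rewrite integral_cst//= probability_setT mule1 integralZl//.
rewrite -[X in _ * X]fineK// -EFinM -EFinD lee_fin -/J mulrAC.
have : (C * J / l <= 1/2)%R by rewrite ler_pdivrMr//; lra.
by lra.
Qed.

(** Along prices decreasing to [l] the demand increases, so monotone convergence
    keeps the expectation at most 1.  The limit may be infinite, but only on a
    null set; this is why optimality holds almost everywhere. The price
    [l = 0] is included. *)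
Lemma demand_limit_above l : (0 <= l)%R ->
  (forall l', (l < l')%R -> expected_demand l' <= 1) ->
  exists eps : T -> \bar R, valid_evalue P eps /\
    {ae P, forall t, exists2 z, eps t = z%:E & optimal_at l (q t) z}.
Proof.
move=> l0 El; pose l_ n : R := (l + harmonic n)%R.
have ll n : (l < l_ n)%R by rewrite ltrDl harmonic_gt0.
have l_gt0 n : (0 < l_ n)%R by exact: le_lt_trans (ll n).
have cl : l_ @ \oo --> l.
  by rewrite -[X in _ --> X]addr0; apply: cvgD; [exact: cvg_cst|exact: cvg_harmonic].
pose g n t := (demand (l_ n) (q t))%:E.
have mg n : measurable_fun [set: T] (g n) by exact: measurable_demand.
have g0 n t : 0 <= g n t by rewrite lee_fin demand_ge0.
have ndg t : nondecreasing_seq (g ^~ t).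
  move=> m n mn; rewrite lee_fin demand_antitone//.
  by rewrite lerD2l /= lef_pV2 ?posrE// ler_nat.
pose eps t := limn (g ^~ t).
have cg t : g ^~ t @ \oo --> eps t by exact: ereal_nondecreasing_is_cvgn.
have eps0 t : 0 <= eps t by apply: lime_ge; [exact: cg|exact: nearW].
have meps : measurable_fun [set: T] eps by apply: emeasurable_fun_cvg mg _ => t _.
have eps1 : \int[P]_t eps t <= 1.
  rewrite monotone_convergence//; apply: lime_le.
    apply: ereal_nondecreasing_is_cvgn => m n mn.
    by apply: ge0_le_integral => // t _; exact: ndg.
  by apply: nearW => n; exact: El.
exists eps; split => //.
have ieps : P.-integrable [set: T] eps.
  apply/integrableP; split => //.
  under eq_integral do rewrite gee0_abs//.
  exact: le_lt_trans eps1 (ltry _).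
apply: filterS (integrable_ae measurableT ieps) => t /(_ Logic.I) ft.
exists (fine (eps t)); first by rewrite fineK.
apply: (@optimal_at_closed l_ (fun n => demand (l_ n) (q t))) => //.
- by move=> n; exact: demand_optimal.
- by have := cg t; rewrite -(fineK ft) => /fine_cvg; exact.
Qed.

(** Along prices increasing to [l] the demand decreases, and it is dominated by
    the demand at price [l / 2] once the prices are kept above [l / 2]. *)
Lemma demand_limit_below l : (0 < l)%R ->
  (forall l', (0 < l')%R -> (l' < l)%R -> 1 <= expected_demand l') ->
  exists eps : T -> R, [/\ measurable_fun [set: T] eps,
    P.-integrable [set: T] (EFin \o eps), 1 <= \int[P]_t (eps t)%:E &
    forall t, optimal_at l (q t) (eps t)].
Proof.
move=> l0 El; pose l_ n : R := (l - l / 2 * harmonic n)%R.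
have h1 n : (harmonic n <= 1 :> R)%R by rewrite /= invf_le1// ler1n.
have ll n : (l_ n < l)%R.
  by rewrite ltrBlDr ltrDl mulr_gt0 ?harmonic_gt0// divr_gt0.
have l2 n : (l / 2 <= l_ n)%R by have := h1 n; rewrite /l_; nra.
have l20 : (0 < l / 2)%R by rewrite divr_gt0.
have l_gt0 n : (0 < l_ n)%R by exact: lt_le_trans (l2 n).
have cl : l_ @ \oo --> l.
  rewrite [X in _ --> X](_ : l = (l - l / 2 * 0)%R); last by rewrite mulr0 subr0.
  apply: cvgB; first exact: cvg_cst.
  by apply: cvgM; [exact: cvg_cst|exact: cvg_harmonic].
pose g n t := demand (l_ n) (q t).
have cg t : g ^~ t @ \oo --> limn (g ^~ t).
  apply: nonincreasing_is_cvgn.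
    move=> m n mn; apply: demand_antitone => //.
    rewrite lerD2l lerN2 ler_pM2l// /= lef_pV2 ?posrE// ler_nat//.
  by exists 0%R => _ [n _ <-]; exact: demand_ge0.
pose eps t := limn (g ^~ t).
have meps : measurable_fun [set: T] eps.
  apply: (@measurable_fun_cvg _ _ _ _ g) => [n|t _]; last exact: cg.
  by apply/measurable_EFinP; exact: measurable_demand.
have [] := @dominated_convergence _ _ _ P [set: T] measurableT
  (fun n => EFin \o g n) (EFin \o eps) (EFin \o (demand (l / 2) \o q)).
- by move=> n; exact: measurable_demand.
- exact/measurable_EFinP.
- by apply: aeW => t _; apply: cvg_EFin; [exact: nearW|exact: cg].
- exact: demand_integrable.
- apply: aeW => t n _; rewrite /= lee_fin ger0_norm ?demand_ge0//.
  exact: demand_antitone.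
move=> ieps _ ceps; exists eps; split => //.
- rewrite -(cvg_lim _ ceps)//; apply: lime_ge; first by apply/cvg_ex; eexists; exact: ceps.
  by apply: nearW => n; exact: El.
- move=> t; apply: (@optimal_at_closed l_ (g ^~ t)) => //.
  by move=> n; exact: demand_optimal.
Qed.

(** The price is the supremum of those at which the expected demand exceeds 1.
    The expected demand may jump over 1 there; mixing its two one-sided limits
    fills the jump. *)
Lemma optimal_evalue_exists : exists l (eps : T -> \bar R),
  [/\ (0 <= l)%R, valid_evalue P eps,
    {ae P, forall t, exists2 z, eps t = z%:E & optimal_at l (q t) z} &
    l%:E * (1 - \int[P]_t eps t) = 0].
Proof.
have [L HL] := expected_demand_le1.
pose S := [set l : R | (0 < l)%R /\ 1 < expected_demand l].
have [[l1 Sl1]|noS] := pselect (exists l, S l); last first.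
  have [|eps [veps oeps]] := demand_limit_above (lexx 0%R).
    move=> l l0; rewrite leNgt; apply/negP => El; apply: noS.
    by exists l.
  by exists 0%R, eps; split => //; rewrite mul0e.
have ubS : ubound S L.
  move=> l [l0 El]; rewrite leNgt; apply/negP => /ltW/HL.
  by rewrite leNgt El.
have supS : has_sup S by split; [exists l1|exists L].
have l0 : (0 < sup S)%R.
  by apply: lt_le_trans Sl1.1 _; apply: ub_le_sup => //; exists L.
have [|dn [vdn odn]] := demand_limit_above (ltW l0).
  move=> l ll; rewrite leNgt; apply/negP => El.
  have : (l <= sup S)%R.
    by apply: ub_le_sup; [exists L|split => //; exact: lt_trans ll].
  by rewrite leNgt ll.
have [|up [mup iup up1 oup]] := demand_limit_below l0.
  move=> l lpos ll; have [l' [l'0 El'] ll'] := sup_gt (ex_intro _ _ Sl1) ll.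
  by apply: le_trans (ltW El') _; apply: expected_demand_antitone => //; exact: ltW.
have [mdn dn0 dn1] := vdn.
have up0 t : 0 <= (up t)%:E by rewrite lee_fin; exact: (oup t).1.
have aE : \int[P]_t dn t \is a fin_num.
  by rewrite ge0_fin_numE ?integral_ge0//; exact: le_lt_trans dn1 (ltry _).
have bE : \int[P]_t (up t)%:E \is a fin_num by exact: integrable_fin_num.
pose a := fine (\int[P]_t dn t); pose b := fine (\int[P]_t (up t)%:E).
have a1 : (a <= 1)%R by rewrite -lee_fin fineK.
have b1 : (1 <= b)%R by rewrite -lee_fin fineK.
(* If [a = b], both are equal to 1 and any weight works. *)
have [c c01 cE] : exists2 c : R, (0 <= c <= 1)%R & (c * b + (1 - c) * a = 1)%R.
  have [ab|ab] := eqVneq a b; first by exists 1%R; lra.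
  have ba : (0 < b - a)%R by rewrite subr_gt0 lt_neqAle ab/=; lra.
  exists ((1 - a) / (b - a))%R.
    by rewrite divr_ge0/= ?ler_pdivrMr//; lra.
  by field; rewrite gt_eqF.
have /andP[c0 c1] := c01.
pose eps t := c%:E * (up t)%:E + (1 - c)%:E * dn t.
have c0' : 0 <= c%:E by rewrite lee_fin.
have c1' : 0 <= (1 - c)%:E by rewrite lee_fin subr_ge0.
have mup' : measurable_fun [set: T] (EFin \o up) by exact/measurable_EFinP.
have ieps : \int[P]_t eps t = 1.
  rewrite ge0_integralD//; last 4 first.
  - by move=> t _; rewrite mule_ge0.
  - exact: measurable_funeM.
  - by move=> t _; rewrite mule_ge0.
  - exact: measurable_funeM.
  rewrite !ge0_integralZl//.
  by rewrite -[X in _ * X + _]fineK// -[X in _ + _ * X]fineK// -!EFinM -EFinD cE.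
exists (sup S), eps; split.
- exact: ltW.
- split; last by rewrite ieps.
  + by apply: emeasurable_funD; exact: measurable_funeM.
  + by move=> t; rewrite adde_ge0// mule_ge0.
- apply: filterS odn => t [z zE oz].
  exists (c * up t + (1 - c) * z)%R; first by rewrite /eps zE.
  exact: optimal_at_convex.
- by rewrite ieps subee// mule0.
Qed.

End expected_demand.
End maximizers.

(** * Integration against a density version *)

Section density.
Context d (T : measurableType d) (R : realType).

Lemma null_dominates_ae (nu mu : {measure set T -> \bar R}) (A : T -> Prop) :
  nu `<< mu -> {ae mu, forall x, A x} -> {ae nu, forall x, A x}.
Proof.
move=> numu [N [mN N0 AN]]; exists N; split => //.
apply: (numu N) => // B mB BN; apply/eqP; rewrite eq_le measure_ge0 andbT.
by rewrite -N0 le_measure// inE.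
Qed.

Variables (nu : {finite_measure set T -> \bar R})
  (mu : {sigma_finite_measure set T -> \bar R}) (q : T -> R).
Hypothesis numu : nu `<< mu.
Hypothesis hq : density_version nu mu q.

Lemma integral_density (f : T -> \bar R) : (forall x, 0 <= f x) ->
  measurable_fun [set: T] f ->
  \int[mu]_x ((q x)%:E * f x) = \int[nu]_x f x.
Proof.
move=> f0 mf; have [mq q0 qE] := hq.
rewrite -(@Radon_Nikodym_SigmaFinite.change_of_variables _ _ _ nu mu)//.
have mrn : measurable_fun [set: T] (Radon_Nikodym_SigmaFinite.f nu mu).
  by apply: measurable_int; exact: Radon_Nikodym_SigmaFinite.f_integrable.
apply: ge0_ae_eq_integral => //.
- by apply: emeasurable_funM => //; exact/measurable_EFinP.
- exact: emeasurable_funM.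
- by move=> x _; rewrite mule_ge0// lee_fin.
- by move=> x _; rewrite mule_ge0// Radon_Nikodym_SigmaFinite.f_ge0.
have := ae_eq_Radon_Nikodym_SigmaFinite numu measurableT.
apply: filterS2 qE => x + + _ => /(_ Logic.I)/= -> /(_ Logic.I) ->.
by rewrite muleC.
Qed.

Lemma density_integrable : mu.-integrable [set: T] (EFin \o q).
Proof.
have [mq q0 _] := hq; apply/integrableP; split; first exact/measurable_EFinP.
have := @integral_density (cst 1) (fun=> lee01) (measurable_cst _).
rewrite integral_cst// mul1e.
under eq_integral do rewrite mule1.
under [X in _ -> X < _]eq_integral do rewrite /= ger0_norm//.
by move=> ->; rewrite ltey_eq fin_num_measure.
Qed.

Lemma density_gt0 : {ae nu, forall x, (0 < q x)%R}.
Proof.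
have [mq q0 _] := hq; pose N := q @^-1` [set 0%R].
have mN : measurable N by rewrite -[N]setTI; apply: mq.
have mI : measurable_fun [set: T] (fun x => (\1_N x)%:E : \bar R).
  exact/measurable_EFinP.
exists N; split => //.
- have := integral_density (fun x => _ : 0 <= (\1_N x)%:E) mI.
  rewrite integral_indic// setIT => <-; last by move=> x; rewrite lee_fin.
  rewrite integral0_eq// => x _; rewrite indicE.
  have [/set_mem /= ->|_] := boolP (x \in N); first by rewrite mul0e.
  by rewrite mule0.
- by move=> x /= /negP; rewrite -leNgt => qx; apply/eqP; rewrite eq_le qx q0.
Qed.

End density.

(** * Optimality in expected utility *)

Section optimality.
Context d (T : measurableType d) (R : realType) (P : probability T R).
Variables (Qa : {finite_measure set T -> \bar R}) (q : T -> R).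
Hypothesis QaP : Qa `<< P.
Hypothesis hq : density_version Qa P q.
Variable U : \bar R -> \bar R.
Hypothesis mU : measurable_fun [set z : \bar R | 0 <= z] U.
Let u z := U z%:E.
Hypothesis concave_u : concave_on [set z : R | (0 <= z)%R] u.
Hypothesis fin_u : forall z : R, (0 < z)%R -> u z \is a fin_num.

Lemma measurable_utility (eps : T -> \bar R) : measurable_fun [set: T] eps ->
  (forall t, 0 <= eps t) -> measurable_fun [set: T] (U \o eps).
Proof.
move=> meps eps0; apply: (measurable_comp _ _ mU meps).
- rewrite (_ : [set _ | _] = `[0, +oo]%classic); first exact: emeasurable_itv.
  by apply/seteqP; split=> z /=; rewrite in_itv/= leey andbT.
- by move=> _ [t _ <-]; exact: eps0.
Qed.

(** This is [r * h >= l * z - l * w] for [h = u z - u w], split into the positive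
    and negative parts of [h] so that both sides are nonnegative and can be
    integrated before integrability of [h] is known. *)
Lemma optimal_at_variation l r z w : (0 <= l)%R -> (0 <= r)%R ->
  optimal_at u l r z -> (0 <= w)%R ->
  r%:E * maxe (- (u z - u w)) 0 <= (l * w)%:E /\
  r%:E * maxe (- (u z - u w)) 0 + (l * z)%:E <=
    r%:E * maxe (u z - u w) 0 + (l * w)%:E.
Proof.
move=> l0 r0 oz w0; have := optimal_at_argmax concave_u fin_u l0 r0 oz w0.
have lw0 : (0 <= l * w)%R by rewrite mulr_ge0.
have lz0 : (0 <= l * z)%R by rewrite mulr_ge0//; exact: oz.1.
move: r0; rewrite le_eqVlt => /predU1P[<-|r0].
  by rewrite !mul0e !add0e leeN2.
have uz := optimal_at_fin_num concave_u fin_u r0 oz.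
rewrite -[u z]fineK//; set a := fine (u z).
case: (u w) (utility_lty concave_u fin_u w0) => [b| |]// _.
- rewrite -!EFinM -!EFinB lee_fin => h.
  rewrite -EFinN -!EFin_max -!EFinM -!EFinD !lee_fin.
  split.
    rewrite maxEle; case: ifPn => //; first by rewrite mulr0.
    by rewrite -ltNge => _; lra.
  rewrite !maxEle; case: ifPn => h1; case: ifPn => h2; rewrite -?ltNge in h1 h2; nra.
- move=> _ /=.
  rewrite addey// /= max_r ?leNye// mule0 max_l ?leey// gt0_muley ?lte_fin//.
  by rewrite addye// leey lee_fin.
Qed.

(** Integrating the first pointwise inequality shows that [h^-] is
    [Qa]-integrable.  Integrating the second compares [\int h^- + l * E eps] with
    [\int h^+ + l * E eps'], and slackness gives [l * E eps = l >= l * E eps']. *)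
Lemma optimal_at_U_optimal l (eps : T -> \bar R) : (0 <= l)%R ->
  valid_evalue P eps ->
  {ae P, forall t, exists2 z, eps t = z%:E & optimal_at u l (q t) z} ->
  l%:E * (1 - \int[P]_t eps t) = 0 ->
  {ae Qa, forall t, U (eps t) \is a fin_num} ->
  U_optimal P Qa U eps.
Proof.
move=> l0 veps oeps slack feps; split => // eps' veps' h.
have [mq q0 _] := hq.
have [meps eps0 eps1] := veps; have [meps' eps'0 eps'1] := veps'.
have mh : measurable_fun [set: T] h.
  by apply: emeasurable_funB; exact: measurable_utility.
have ieps' : P.-integrable [set: T] eps'.
  apply/integrableP; split => //.
  under eq_integral do rewrite gee0_abs//.
  exact: le_lt_trans eps'1 (ltry _).
have mqE : measurable_fun [set: T] (EFin \o q) by exact/measurable_EFinP.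
have mhp := measurable_funepos mh; have mhn := measurable_funeneg mh.
have var : {ae P, forall t, (q t)%:E * h^\- t <= l%:E * eps' t /\
    (q t)%:E * h^\- t + l%:E * eps t <= (q t)%:E * h^\+ t + l%:E * eps' t}.
  apply: filterS2 oeps (integrable_ae measurableT ieps') => t [z zE oz].
  move=> /(_ Logic.I) fe'; rewrite funeposE funenegE /h zE -(fineK fe') -!EFinM.
  by apply: optimal_at_variation => //; rewrite fine_ge0.
have qE t : 0 <= (q t)%:E by rewrite lee_fin.
have lE : 0 <= l%:E by rewrite lee_fin.
have qhp0 t : 0 <= (q t)%:E * h^\+ t by rewrite mule_ge0.
have qhn0 t : 0 <= (q t)%:E * h^\- t by rewrite mule_ge0.
have leps0 t : 0 <= l%:E * eps t by rewrite mule_ge0.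
have leps'0 t : 0 <= l%:E * eps' t by rewrite mule_ge0.
have mqhp : measurable_fun [set: T] (fun t => (q t)%:E * h^\+ t).
  exact: emeasurable_funM.
have mqhn : measurable_fun [set: T] (fun t => (q t)%:E * h^\- t).
  exact: emeasurable_funM.
have mleps : measurable_fun [set: T] (fun t => l%:E * eps t).
  exact: measurable_funeM.
have mleps' : measurable_fun [set: T] (fun t => l%:E * eps' t).
  exact: measurable_funeM.
have hn : \int[Qa]_t h^\- t <= l%:E * \int[P]_t eps' t.
  rewrite -(integral_density QaP hq)// -ge0_integralZl//.
  by apply: ae_ge0_le_integral => //; apply: filterS var => t [].
have fe' : \int[P]_t eps' t \is a fin_num by exact: integrable_fin_num.
have hn_lty : \int[Qa]_t h^\- t < +oo.
  by apply: le_lt_trans hn _; rewrite -(fineK fe') -EFinM ltry.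
have hnp : \int[Qa]_t h^\- t + l%:E * \int[P]_t eps t <=
    \int[Qa]_t h^\+ t + l%:E * \int[P]_t eps' t.
  rewrite -!(integral_density QaP hq)// -!ge0_integralZl// -!ge0_integralD//.
  apply: ae_ge0_le_integral => //.
  - by move=> t _; rewrite adde_ge0.
  - exact: emeasurable_funD.
  - by move=> t _; rewrite adde_ge0.
  - exact: emeasurable_funD.
  - by apply: filterS var => t [].
have fe : \int[P]_t eps t \is a fin_num.
  by rewrite ge0_fin_numE ?integral_ge0//; exact: le_lt_trans eps1 (ltry _).
split.
- by apply: filterS feps => t ft; rewrite fin_num_adde_defr.
- by right.
- rewrite integralE.
  have hn0 : 0 <= \int[Qa]_t h^\- t by exact: integral_ge0.
  have hp0 : 0 <= \int[Qa]_t h^\+ t by exact: integral_ge0.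
  move: hn0 hn_lty hnp slack eps'1 hp0.
  case: (\int[Qa]_t h^\- t) => [a| |]// _ _; rewrite -(fineK fe) -(fineK fe').
  set e := fine _; set e' := fine _.
  case: (\int[Qa]_t h^\+ t) => [b| |]//.
  rewrite -!EFinM -!EFinD !lee_fin => ab [le1] e'1 _.
  by have := ler_wpM2l l0 e'1; rewrite subr_ge0; lra.
Qed.

End optimality.

Theorem corollary1 (d : measure_display) (T : measurableType d) (R : realType)
  (P Q : probability T R)
  (Qa Qs : {finite_measure set T -> \bar R})
  (hQ : lebesgue_decomposition Q P Qa Qs)
  (q : T -> R) (hq : density_version Qa P q)
  (U : \bar R -> \bar R)
  (mU : measurable_fun [set z : \bar R | 0 <= z] U)
  (concaveU : concave_on [set z : R | (0 <= z)%R] (fun z => U z%:E))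
  (uscU : upper_semicontinuous_on [set z : R | (0 <= z)%R] (fun z => U z%:E))
  (finU : forall z : R, (0 < z)%R -> U z%:E \is a fin_num)
  (growthU : exists K : R, (0 <= K)%R /\
    forall x y : R, (1 <= x)%R -> (x <= y)%R ->
      U y%:E - U x%:E <= (K * ln (y / x))%:E) :
  (exists (lam : R) (eps : T -> \bar R),
    [/\ (0 <= lam)%R,
        valid_evalue P eps,
        {ae P, forall x,
          argmax [set z : \bar R | 0 <= z < +oo]
            (fun z => (q x)%:E * U z - lam%:E * z) (eps x)},
        lam%:E * (1 - \int[P]_x eps x) = 0 &
        {ae Qa, forall x, U (eps x) \is a fin_num}]) /\
  (exists eps : T -> \bar R, U_optimal P Qa U eps).
Proof.
have [_ QaP _] := hQ; have [mq q0 _] := hq; have [K [K0 growth]] := growthU.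
have [lam [eps [lam0 veps oeps slack]]] := optimal_evalue_exists concaveU uscU
  finU K0 growth mq q0 (density_integrable QaP hq).
have feps : {ae Qa, forall x, U (eps x) \is a fin_num}.
  have oepsQ := null_dominates_ae QaP oeps.
  apply: filterS2 oepsQ (density_gt0 QaP hq) => x [z -> oz] qx.
  exact: optimal_at_fin_num oz.
split; last first.
  exists eps; exact: (@optimal_at_U_optimal _ _ _ _ _ q _ _ _ _ _ _ lam).
exists lam, eps; split => //.
apply: filterS oeps => x [z -> oz]; split.
  by rewrite /= lee_fin ltry andbT; exact: oz.1.
move=> [w| |]//= /andP[]; rewrite ?ltxx// lee_fin => w0 _.
exact: (optimal_at_argmax concaveU finU lam0 (q0 x) oz w0).
Qed.
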